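(* Let $q$ be a prime power and let $n,m,h$ be positive integers with $m\geq 3$ and $2\leq h\leq n-2$. Let $\mathbf{A}=(\alpha_1,\dots,\alpha_m)\in(\mathbb{F}_{q^n}^* )^m$ be such that $K_{\mathbf{A}}:=\alpha_1^{q^{m-1}}\alpha_2\alpha_3^{q}\cdots\alpha_m^{q^{m-2}}$ is not a $(1+q+q^2+\cdots+q^{m-1})$-th power in $\mathbb{F}_{q^n}$. Then the $\mathbb{F}_q$-subspace $$V_{\mathbf{A},h}:=\{(\underline{x},\underline{x}^q,\dots,\underline{x}^{q^{h-1}},f_1(\underline{x}),\dots,f_m(\underline{x})):\underline{x}\in\mathbb{F}_{q^n}^m\}\subseteq\mathbb{F}_{q^n}^{m(h+1)},$$ where $f_i(\underline{x})=x_i^{q^h}+\alpha_{i+1}x_{i+1}^{q^{h+1}}$ for $i=1,\dots,m-1$ and $f_m(\underline{x})=x_m^{q^h}+\alpha_1x_1^{q^{h+1}}$, is a maximum $h$-scattered $\mathbb{F}_q$-subspace of $\mathbb{F}_{q^n}^{m(h+1)}$.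
   Context: For $\underline{x}=(x_1,\dots,x_m)\in\mathbb{F}_{q^n}^m$, $\underline{x}^{q^j}$ denotes $(x_1^{q^j},\dots,x_m^{q^j})$. Let $V$ be an $r$-dimensional $\mathbb{F}_{q^n}$-vector space and $0<h\leq r-1$. An $\mathbb{F}_q$-subspace $U$ of $V$ is $h$-scattered if $\langle U\rangle_{\mathbb{F}_{q^n}}=V$ and every $h$-dimensional $\mathbb{F}_{q^n}$-subspace of $V$ meets $U$ in an $\mathbb{F}_q$-subspace of dimension at most $h$. An $h$-scattered subspace not defining a subgeometry has $\mathbb{F}_q$-dimension at most $rn/(h+1)$; it is called maximum $h$-scattered if its dimension equals $rn/(h+1)$ (here $r=m(h+1)$, so $rn/(h+1)=mn$). *)

(* Defs.v *)
From HB Require Import structures.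
From mathcomp Require Import all_boot all_order all_fingroup all_algebra.
From mathcomp Require Import all_solvable all_field.

Set Implicit Arguments.
Unset Strict Implicit.
Unset Printing Implicit Defensive.

Import GRing.Theory.
Local Open Scope ring_scope.

(* [resScalars V] is the L-vector space V seen as a vector space over the      *)
(* base field F of the extension L; it is the analogue of [baseFieldType] for  *)
(* vector spaces.  An F-subspace of V is a [U : {vspace resScalars V}], with   *)
(* [\dim U] its dimension over F, while a [W : {vspace V}] is an L-subspace,   *)
(* with [\dim W] its dimension over L.                                         *)
Definition resScalars (F : fieldType) (L : fieldExtType F) (V : vectType L)
  : Type := V.

Section RestrictionOfScalars.

Variables (F : fieldType) (L : fieldExtType F) (V : vectType L).
Local Notation VF := (resScalars V).

HB.instance Definition _ := GRing.Zmodule.on VF.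

Definition resScalars_scale (a : F) (u : VF) : VF := (a%:A : L) *: (u : V).
Local Infix "*F:" := resScalars_scale (at level 40).

Fact resScalars_scaleA a b u : a *F: (b *F: u) = (a * b) *F: u.
Proof. by rewrite /resScalars_scale scalerA -scalerAl mul1r scalerA. Qed.

Fact resScalars_scale1 u : 1 *F: u = u.
Proof. by rewrite /resScalars_scale !scale1r. Qed.

Fact resScalars_scaleDr a u v : a *F: (u + v) = a *F: u + a *F: v.
Proof. exact: scalerDr. Qed.

Fact resScalars_scaleDl v a b : (a + b) *F: v = a *F: v + b *F: v.
Proof. by rewrite /resScalars_scale !scalerDl. Qed.

HB.instance Definition _ := GRing.Zmodule_isLmodule.Build F VF
  resScalars_scaleA resScalars_scale1 resScalars_scaleDr resScalars_scaleDl.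

Lemma resScalars_scaleE (a : F) (u : V) :
  a *: (u : VF) = (a%:A : L) *: u :> V.
Proof. by []. Qed.

Fact resScalars_vectMixin : Lmodule_hasFinDim F VF.
Proof.
set n := \dim {:L}; set m := \dim {:V}.
pose bF : n.-tuple L := vbasis {:L}; pose bL : m.-tuple V := vbasis {:V}.
pose w2r (x : VF) := mxvec (\matrix_(i < m, j < n) coord bF j (coord bL i x)).
have w2r_lin: linear w2r.
  move=> a x y; rewrite -linearP; congr mxvec; apply/matrixP=> i j.
  by rewrite !mxE linearP /= mulr_algl linearP.
pose w r : VF := \sum_(i < m) (\sum_(j < n) vec_mx r i j *: bF`_j) *: bL`_i.
have w2rK: cancel w2r w.
  move=> x; rewrite {2}(coord_vbasis (memvf (x : V))).
  apply: eq_bigr => i _; rewrite mxvecK; congr (_ *: _ : V).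
  rewrite (coord_vbasis (memvf (coord bL i (x : V)))).
  by apply: eq_bigr => j _; rewrite mxE.
exists (m * n)%N, w2r => //; exists w => // r.
apply: (canLR vec_mxK); apply/matrixP=> i j; rewrite mxE.
by rewrite !coord_sum_free ?(basis_free (vbasisP _)).
Qed.

HB.instance Definition _ := resScalars_vectMixin.

(* An L-subspace of V, seen as an F-subspace. *)
Definition resSpace (W : {vspace V}) : {vspace VF} :=
  <<([seq a *: b | a <- vbasis {:L}, b <- vbasis W] : seq VF)>>%VS.

Lemma mem_resSpace (W : {vspace V}) (v : V) :
  ((v : VF) \in resSpace W) = (v \in W).
Proof.
apply/idP/idP => [Sv | Wv].
  pose S : seq V := [seq a *: b | a <- vbasis {:L}, b <- vbasis W].
  have Dv := @coord_span F VF _ (in_tuple (S : seq VF)) v Sv.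
  have {Dv} -> : v = \sum_(i < size S)
    ((coord (in_tuple (S : seq VF)) i (v : VF))%:A : L) *: S`_i := Dv.
  apply: memv_suml => i _; apply: memvZ.
  have /allpairsP[[a b] /= [_ Wb ->]] := mem_nth (0 : V) (ltn_ord i).
  by rewrite memvZ ?(vbasis_mem Wb).
have -> : (v : VF) = \sum_(i < \dim W) \sum_(j < \dim {:L})
    (coord (vbasis {:L}) j (coord (vbasis W) i v) *:
      ((vbasis {:L})`_j *: (vbasis W)`_i : VF) : VF).
  rewrite {1}(coord_vbasis Wv); apply: eq_bigr => i _.
  rewrite {1}(coord_vbasis (memvf (coord _ i v))) scaler_suml.
  apply: eq_bigr => j _; rewrite resScalars_scaleE scalerA.
  by rewrite -scalerAl mul1r.
apply: memv_suml => i _; apply: memv_suml => j _; apply/memvZ/memv_span.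
by apply: allpairs_f; rewrite mem_nth ?size_tuple.
Qed.

(* The L-span of an F-subspace of V. *)
Definition extSpan (U : {vspace VF}) : {vspace V} :=
  <<(vbasis U : seq V)>>%VS.

Lemma extSpan_subvP (U : {vspace VF}) (W : {vspace V}) :
  reflect (forall v : V, (v : VF) \in U -> v \in W) (extSpan U <= W)%VS.
Proof.
apply: (iffP span_subvP) => [sUW v Uv | sUW v Uv].
  2: by apply: sUW; apply: (@vbasis_mem F VF v U).
rewrite -mem_resSpace (coord_vbasis Uv).
apply: memv_suml => i _; apply: memvZ; rewrite mem_resSpace.
by apply: sUW; apply: (@mem_nth VF); rewrite size_tuple.
Qed.

Definition hscattered (h : nat) (U : {vspace VF}) : Prop :=
  [/\ (0 < h <= (\dim {:V}).-1)%N,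
      extSpan U = fullv
    & forall W : {vspace V}, \dim W = h -> (\dim (U :&: resSpace W) <= h)%N].

(* U defines a (canonical) subgeometry of PG(V): an F-structure of V. *)
Definition defines_subgeometry (U : {vspace VF}) : Prop :=
  \dim U = \dim {:V} /\ extSpan U = fullv.

(* The last equation is \dim U = rn/(h+1), with r = \dim V and n = [L : F]. *)
Definition maximum_hscattered (h : nat) (U : {vspace VF}) : Prop :=
  [/\ hscattered h U, ~ defines_subgeometry U
    & (\dim U)%:R = (\dim {:V} * \dim {:L})%:R / h.+1%:R :> rat].

End RestrictionOfScalars.

(* \prod_i a_{i+1}^{q^i}, indices mod m: with a_0, ..., a_{m-1} for            *)
(* alpha_1, ..., alpha_m, the factor i = m-1 is alpha_1^{q^{m-1}}.             *)
Definition KA (R : pzRingType) (q m : nat) (a : 'I_m -> R) : R :=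
  \prod_(i < m) a (ordS i) ^+ (q ^ i).

Section VA.

Variables (F : finFieldType) (L : fieldExtType F).
Variables (m : nat) (a : 'I_m -> L) (h : nat).
Local Notation q := #|F|.

Definition fA (x : 'rV[L]_m) (i : 'I_m) : L :=
  x 0 i ^+ (q ^ h) + a (ordS i) * x 0 (ordS i) ^+ (q ^ h.+1).

(* Flattened row by row by [mxvec]: x, x^q, ..., x^{q^(h-1)}, then f(x). *)
Definition vecA (x : resScalars 'rV[L]_m) : resScalars 'rV[L]_(h.+1 * m) :=
  mxvec (\matrix_(j < h.+1, i < m)
           if (j < h)%N then (x : 'rV[L]_m) 0 i ^+ (q ^ j) else fA x i).

Lemma frobenius_is_linear (k : nat) : linear (fun x : L => x ^+ (q ^ k)).
Proof.
have [p p_pr charFp] := finPcharP F.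
have q_nat : [pchar L].-nat (q ^ k)%N.
  rewrite pnatX; apply/orP; left.
  rewrite (eq_pnat _ (@pchar_lalg F L)) (eq_pnat _ (pcharf_eq charFp)) -cardsT.
  by apply: (abelem_pgroup (fin_ring_pchar_abelem charFp)).
move=> b x y; rewrite exprDn_pchar // exprZn; congr (_ *: _ + _).
by elim: k {q_nat} => [|k IHk]; rewrite ?expn0 ?expr1 // expnSr exprM IHk expf_card.
Qed.

Fact vecA_is_linear : linear vecA.
Proof.
have frobP k (b : F) (x y : L) :
    (b%:A * x + y) ^+ (q ^ k) = b%:A * x ^+ (q ^ k) + y ^+ (q ^ k).
  by rewrite !mulr_algl frobenius_is_linear.
move=> b x y; rewrite /vecA resScalars_scaleE -linearP; congr mxvec.
apply/matrixP=> j i; rewrite !mxE; case: ifP => _; first exact: frobP.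
by rewrite /fA !mxE !frobP !mulrDr mulrCA !addrA; congr (_ + _); rewrite addrAC.
Qed.

HB.instance Definition _ := GRing.isLinear.Build F _ _ _ vecA vecA_is_linear.

Definition VA : {vspace resScalars 'rV[L]_(h.+1 * m)} := limg (linfun vecA).

Lemma mem_VA v : reflect (exists x, v = vecA x) (v \in VA).
Proof.
apply: (iffP memv_imgP) => [[x _ ->]|[x ->]]; first by exists x; rewrite lfunE.
by exists x; rewrite ?memvf ?lfunE.
Qed.

End VA.

(* Main.v *)
Require Import Defs.
From mathcomp Require Import all_boot all_order all_algebra all_field.
From HB Require Import structures.

(* An [L]-relation c among h+1 elements of the subspace, with parameters      *)
(* x_0, ..., x_h, says that c kills X_i, X_i^q, ..., X_i^(q^(h-1)) for each   *)
(* coordinate vector X_i = (x_(0,i), ..., x_(h,i)), plus one relation linking *)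
(* c.X_i^(q^h) to alpha_(i+1) c.X_(i+1)^(q^(h+1)).  If every X_i has          *)
(* F-dependent entries, c kills the images of X_i under all F-linear maps,    *)
(* and any nonzero coordinate of c over F is an F-relation among the x_k.     *)
(* Otherwise some X has F-independent entries, every X_i is a multiple        *)
(* l_i X, and the linking relations give alpha_(i+1) l_(i+1)^(q^(h+1)) =      *)
(* u l_i^(q^h) with u independent of i; weighting these by q^i, the l_i       *)
(* telescope and K_A is a (1 + q + ... + q^(m-1))-th power.                   *)

Set Implicit Arguments.
Unset Strict Implicit.
Unset Printing Implicit Defensive.

Import GRing.Theory.
Local Open Scope ring_scope.

(** An [h]-dimensional [L]-subspace meeting the image of [vecA] in [F]-dimension above [h] would
    contain [h+1] vectors of that image that are [F]-independent but [L]-dependent.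
    [vecA_independent] excludes this, since it turns such an [L]-relation into an [F]-relation
    ([VA_meet]). The tool throughout is the Moore matrix of entries [X_k^(q^j)], invertible for
    [F]-independent [X_k] ([moore_unit]): it yields [orth_linear] and [orth_proportional] for the
    two cases of that argument and, with [h+2 <= n] independent elements, the spanning property
    ([extSpan_VA]). As [vecA] is injective, the dimension is [mn] ([dim_VA]). *)

Lemma free_vbasis_take (K : fieldType) (vT : vectType K) (U : {vspace vT}) N :
  (N <= \dim U)%N -> free [tuple (vbasis U)`_k | k < N].
Proof.
move=> le_N.
have -> : [tuple (vbasis U)`_k | k < N] = take N (vbasis U) :> seq vT.
  apply: (@eq_from_nth _ 0) => [|k];
    rewrite size_tuple ?size_takel ?size_tuple //.
  move=> lt_k; rewrite nth_take // -[k]/(nat_of_ord (Ordinal lt_k)).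
  by rewrite -tnth_nth tnth_mktuple.
have := basis_free (vbasisP U); rewrite -{1}(cat_take_drop N (vbasis U)).
exact: catl_free.
Qed.

Lemma dim_resScalars_row (K : fieldType) (E : fieldExtType K) m :
  \dim {:resScalars 'rV[E]_m} = (m * \dim {:E})%N.
Proof.
pose phi (f : {ffun 'I_m -> E}) : resScalars 'rV[E]_m := \row_i f i.
have phi_lin : linear phi.
  move=> b f g; rewrite resScalars_scaleE; apply/rowP => i.
  by rewrite !mxE !ffunE mulr_algl.
pose phiL : {linear {ffun 'I_m -> E} -> resScalars 'rV[E]_m} :=
  HB.pack phi (GRing.isLinear.Build _ _ _ _ phi phi_lin).
have phi_inj : injective phi.
  by move=> f g /rowP fg; apply/ffunP => i; have := fg i; rewrite !mxE.
transitivity (\dim (limg (linfun phiL))).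
  congr (\dim _); apply/esym/eqP; rewrite eqEsubv subvf; apply/subvP => v _.
  apply/memv_imgP; exists [ffun i => (v : 'rV_m) 0 i]; rewrite ?memvf // lfunE.
  by apply/rowP => i; rewrite mxE ffunE.
rewrite limg_dim_eq; first by rewrite !dimvf /dim /= card_ord.
apply/eqP; rewrite -subv0; apply/subvP => f /memv_capP[_].
rewrite memv_ker lfunE memv0 => /eqP f0; apply/eqP/phi_inj.
by rewrite [LHS]f0 [RHS](linear0 phiL).
Qed.

(** * Moore matrices and orthogonality to Frobenius powers *)

Section Moore.

Variables (F : finFieldType) (L : fieldExtType F).
Local Notation q := #|F|.

Definition frob (k : nat) (x : L) : L := x ^+ (q ^ k).

HB.instance Definition _ k :=
  GRing.isLinear.Build F L L _ (frob k) (@frobenius_is_linear F L k).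

Lemma frobM k : {morph frob k : x y / x * y}.
Proof. by move=> x y; apply: exprMn. Qed.

Lemma frob_comp j k x : frob j (frob k x) = frob (k + j) x.
Proof. by rewrite /frob -exprM -expnD. Qed.

Lemma frob_eq0 k x : (frob k x == 0) = (x == 0).
Proof. by rewrite expf_eq0 expn_gt0 (ltnW (finNzRing_gt1 F)). Qed.

(* A nonzero combination of the first [N] powers of Frobenius is a polynomial *)
(* of degree at most [q^(N-1)], too small to vanish on the [q^N] points of    *)
(* the span of [X].                                                           *)
Lemma moore_unit N (X : 'I_N -> L) : free [tuple X k | k < N] ->
  \matrix_(j < N, k < N) frob j (X k) \in unitmx.
Proof.
move=> freeX; rewrite -row_free_unit; apply: inj_row_free => b bM0.
pose p : {poly L} := \sum_(j < N) b 0 j *: 'X^(q ^ j).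
have q_gt1 : (1 < q)%N := finNzRing_gt1 F.
have p_eval x : p.[x] = \sum_(j < N) b 0 j * frob j x.
  by rewrite horner_sum; apply: eq_bigr => j _; rewrite hornerZ hornerXn.
pose pt (v : 'rV[F]_N) := \sum_(k < N) v 0 k *: X k.
have pt_inj : injective pt.
  move=> u v /eqP; rewrite -subr_eq0 -sumrB => /eqP uv0; apply/rowP => i.
  apply/eqP; rewrite -subr_eq0; apply/eqP.
  move/freeP: freeX => /(_ (fun k => u 0 k - v 0 k)); apply.
  rewrite -[RHS]uv0; apply: eq_bigr => k _.
  by rewrite -tnth_nth tnth_mktuple scalerBl.
have p0 : p = 0.
  apply/eqP/negPn/negP => p_neq0.
  have rts : all (root p) (codom pt).
    apply/allP => _ /codomP[v ->]; rewrite rootE p_eval; apply/eqP.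
    transitivity (\sum_(k < N) v 0 k *: \sum_(j < N) b 0 j * frob j (X k)).
      under eq_bigr => j _ do rewrite linear_sum mulr_sumr.
      rewrite exchange_big; apply: eq_bigr => k _; rewrite scaler_sumr.
      by apply: eq_bigr => j _; rewrite linearZ -scalerAr.
    rewrite big1 // => k _; move/rowP: bM0 => /(_ k); rewrite !mxE => bk0.
    rewrite -[RHS](scaler0 _ (v 0 k)) -[in RHS]bk0; congr (_ *: _).
    by apply: eq_bigr => j _; rewrite mxE.
  have := max_poly_roots p_neq0 rts.
  rewrite (map_inj_uniq pt_inj) enum_uniq size_codom card_mx mul1n.
  move=> /(_ isT); apply/negP; rewrite -leqNgt.
  apply/(leq_trans (size_sum _ _ _))/bigmax_leqP => j _.
  by rewrite (leq_trans (size_scale_leq _ _)) // size_polyXn ltn_exp2l.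
apply/rowP => i; rewrite mxE.
have := congr1 (fun r : {poly L} => r`_(q ^ i)) p0; rewrite coef0 => <-.
rewrite coef_sum (bigD1 i) //= coefZ coefXn eqxx mulr1 big1 ?addr0 // => j.
rewrite -val_eqE /= coefZ coefXn eqn_exp2l // eq_sym => /negPf->.
by rewrite mulr0.
Qed.

(** Over a basis [y] of the [F]-span of the [X k], the relations become [w . y^(q^j) = 0]; they are
    at least as many as the entries of [y], so the Moore matrix of [y] forces [w = 0]. *)
Lemma orth_linear N r (c X : 'I_N -> L) (f : {linear L -> L}) :
    (\dim <<[tuple X k | k < N]>> <= r)%N ->
    (forall j, (j < r)%N -> \sum_(k < N) c k * frob j (X k) = 0) ->
  \sum_(k < N) c k * f (X k) = 0.
Proof.
set S := <<_>>%VS => dimS orth.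
pose y (l : 'I_(\dim S)) := (vbasis S)`_l.
pose e k l := coord (vbasis S) l (X k).
have Xy k : X k = \sum_l e k l *: y l.
  apply/coord_vbasis/memv_span/tnthP.
  by exists k; rewrite tnth_mktuple.
pose w := \row_l \sum_k e k l *: c k.
have expand (g : {linear L -> L}) :
    \sum_k c k * g (X k) = \sum_l w 0 l * g (y l).
  under eq_bigr => k _ do rewrite Xy linear_sum mulr_sumr.
  rewrite exchange_big; apply: eq_bigr => l _; rewrite mxE mulr_suml.
  by apply: eq_bigr => k _; rewrite linearZ -scalerAr scalerAl.
have Munit : \matrix_(j, k) frob j (y k) \in unitmx.
  apply: moore_unit; have -> : [tuple y l | l < \dim S] = vbasis S.
    by apply: eq_from_tnth => l; rewrite tnth_mktuple /y -tnth_nth.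
  exact: basis_free (vbasisP S).
have w0 : w = 0.
  rewrite -unitmx_tr in Munit; apply: (can_inj (mulmxK Munit)).
  apply/rowP => j; rewrite mul0mx mxE [RHS]mxE.
  rewrite -[RHS](orth j (leq_trans (ltn_ord j) dimS)) expand.
  by apply: eq_bigr => l _; rewrite !mxE.
by rewrite expand big1 // => l _; rewrite w0 mxE mul0r.
Qed.

(** Taking for [f] a coordinate functional of [L] over [F] and applying [g] shows that this
    coordinate of the sum vanishes. *)
Lemma orth_descent N (c x : 'I_N -> L) (g : {linear L -> F^o}) :
    (forall f : {linear L -> L}, \sum_(k < N) c k * f (x k) = 0) ->
  \sum_(k < N) g (c k) *: x k = 0.
Proof.
move=> orth; rewrite (coord_vbasis (memvf (\sum_k _))).
apply: big1 => l _; rewrite linear_sum.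
pose f : L -> L := in_alg L \o (coord (vbasis fullv) l : L -> F).
have f_lin : linear f.
  by move=> a u v; rewrite /f /= linearP /= scalerDl -scalerA.
pose fL : {linear L -> L} := HB.pack f (GRing.isLinear.Build _ _ _ _ f f_lin).
have := congr1 g (orth fL); rewrite linear0 linear_sum => g0.
suff -> : \sum_(k < N) coord (vbasis {: L}) l (g (c k) *: x k) = 0.
  by rewrite scale0r.
rewrite -[RHS]g0; apply: eq_bigr => k _.
by rewrite /= /f /= mulr_algr !linearZ /= mulrC.
Qed.

(** Otherwise [c] would be a nonzero vector killed by an invertible Moore matrix of size [h+1]. *)
Lemma orth_top_neq0 h (c X : 'I_h.+1 -> L) :
    free [tuple X k | k < h.+1] -> (exists k, c k != 0) ->
    (forall j, (j < h)%N -> \sum_(k < h.+1) c k * frob j (X k) = 0) ->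
  \sum_(k < h.+1) c k * frob h (X k) != 0.
Proof.
move=> /moore_unit; rewrite -unitmx_tr => Munit [i ci] orth.
apply: contraNneq ci => top0.
suff /rowP/(_ i): \row_k c k = 0 by rewrite !mxE => ->.
apply: (can_inj (mulmxK Munit)); rewrite mul0mx; apply/rowP => j.
rewrite mxE [RHS]mxE; under eq_bigr => k _ do rewrite !mxE.
by have := ltn_ord j; rewrite ltnS leq_eqVlt => /predU1P[-> | /orth].
Qed.

(* The Frobenius powers of [X] form a basis; expand [Y] in it and apply       *)
(* [frob t] for t = 0, 1, ... to kill the coefficients from the top down.     *)
Lemma orth_proportional h (c X Y : 'I_h.+1 -> L) :
    free [tuple X k | k < h.+1] ->
    (forall j, (j < h)%N -> \sum_(k < h.+1) c k * frob j (X k) = 0) ->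
    \sum_(k < h.+1) c k * frob h (X k) != 0 ->
    (forall j, (j < h)%N -> \sum_(k < h.+1) c k * frob j (Y k) = 0) ->
  exists b, forall k, Y k = b * X k.
Proof.
move=> /moore_unit Munit orthX topX orthY.
set M := \matrix_(j, k) _ in Munit.
pose b := (\row_k Y k) *m invmx M.
have Yb k : Y k = \sum_j b 0 j * frob j (X k).
  have /rowP/(_ k) : b *m M = \row_k Y k by rewrite mulmxKV.
  rewrite !mxE => <-.
  by apply: eq_bigr => j _; rewrite [M _ _]mxE.
have b0 t : (t <= h)%N -> forall j : 'I_h.+1, (h < j + t)%N -> b 0 j = 0.
  elim: t => [_ j | t IHt lt_th j].
    by rewrite addn0 ltnNge -ltnS ltn_ord.
  rewrite addnS ltnS leq_eqVlt => /predU1P[def_h | ]; last exact/IHt/ltnW.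
  (* Among the terms [b_i^(q^t) * (c . X^(q^(i+t)))], those with [i + t > h] vanish by induction and
     those with [i + t < h] by [orthX]; the remaining one, [i = j], has the nonzero factor
     [topX]. *)
  have := orthY t lt_th.
  under eq_bigr => k _ do rewrite Yb linear_sum mulr_sumr.
  rewrite exchange_big (bigD1 j) //= [X in _ + X]big1 => [|i ne_ij].
    rewrite addr0; under eq_bigr => k _ do
      rewrite frobM frob_comp -def_h mulrCA.
    move/eqP; rewrite -mulr_sumr mulf_eq0 (negPf topX) orbF frob_eq0.
    by move/eqP.
  have [lt_h | ] := ltnP h (i + t).
    by apply: big1 => k _; rewrite (IHt (ltnW lt_th)) // mul0r linear0 mulr0.
  rewrite leq_eqVlt => /predU1P[it_h | lt_it].
    by case/eqP: ne_ij; apply/val_inj/(@addIn t); rewrite /= it_h.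
  rewrite -[RHS](mulr0 (frob t (b 0 i))) -[in RHS](orthX _ lt_it) mulr_sumr.
  by apply: eq_bigr => k _; rewrite frobM frob_comp mulrCA.
exists (b 0 0) => k; rewrite Yb big_ord_recl /= {1}/frob expn0 expr1.
rewrite big1 ?addr0 // => j _.
by rewrite (b0 h) ?mul0r // /lift /= /bump /= add1n addSn ltnS leq_addl.
Qed.

End Moore.

(** Multiplying the [q^i]-th powers of the relations cancels every [l_i] except for a factor
    [l_0^(1 - q^m)], and [q^m - 1] is [q - 1] times [1 + q + ... + q^(m-1)]. *)
Lemma KA_is_power (K : fieldType) (q m : nat) (a l : 'I_m -> K) (u : K) :
    (0 < q)%N -> (0 < m)%N -> (forall i, l i != 0) ->
    (forall i, a (ordS i) * l (ordS i) ^+ q = u * l i) ->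
  exists b, KA q a = b ^+ (\sum_(i < m) q ^ i)%N.
Proof.
case: m => // m in a l *; move=> q_gt0 _ l_neq0 al.
pose g t := (l (inord (t %% m.+1)) ^+ (q ^ t))^-1.
have g_neq0 t : g t != 0 by rewrite invr_eq0 expf_neq0.
exists (u * (l ord0)^-1 ^+ q.-1).
rewrite exprMn -exprM -predn_exp expr_sum.
have -> : (l ord0)^-1 ^+ (q ^ m.+1).-1 = \prod_(i < m.+1) (g i.+1 / g i).
  rewrite -(big_mkord xpredT (fun i => g i.+1 / g i)) telescope_prodf //.
  rewrite /g modnn mod0n.
  have -> : (inord 0 : 'I_m.+1) = ord0 by apply/val_inj; rewrite /= inordK.
  have qm_gt0 : (0 < q ^ m.+1)%N by rewrite expn_gt0 q_gt0.
  rewrite expn0 expr1 invrK -[in RHS](prednK qm_gt0) exprSr exprVn.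
  by rewrite invfM mulfVK.
rewrite -big_split; apply: eq_bigr => i _ /=.
have gS : g i.+1 = (l (ordS i) ^+ (q ^ i.+1))^-1.
  rewrite /g; congr ((l _ ^+ _)^-1); apply/val_inj.
  by rewrite /= inordK ?ltn_pmod.
have gi : g i = (l i ^+ (q ^ i))^-1.
  by rewrite /g modn_small // inord_val.
rewrite gS gi invrK expnS exprM mulrCA mulrC -exprMn -al exprMn mulfK //.
by rewrite !expf_neq0.
Qed.

(** * The subspace: scatteredness, dimension and span *)

Section Scattered.

Variables (F : finFieldType) (L : fieldExtType F) (m h : nat).
Variable a : 'I_m -> L.
Local Notation q := #|F|.

Lemma vecA_lowE x (j : 'I_h.+1) i : (j < h)%N ->
  (vecA a h x : 'rV[L]_(h.+1 * m)) 0 (mxvec_index j i) =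
  frob j ((x : 'rV[L]_m) 0 i).
Proof. by move=> lt_jh; rewrite mxvecE mxE lt_jh. Qed.

Lemma vecA_topE x i :
  (vecA a h x : 'rV[L]_(h.+1 * m)) 0 (mxvec_index ord_max i) =
  frob h ((x : 'rV[L]_m) 0 i)
    + a (ordS i) * frob h.+1 ((x : 'rV[L]_m) 0 (ordS i)).
Proof. by rewrite mxvecE mxE /= ltnn. Qed.

Lemma iter_ordS_onto (i j : 'I_m) : exists t, iter t (@ordS m) i = j.
Proof.
have val_iter t : iter t (@ordS m) i = ((i + t) %% m)%N :> nat.
  elim: t => [|t IHt] /=; first by rewrite addn0 modn_small.
  by rewrite IHt -addn1 modnDml addn1 addnS.
exists (m - i + j)%N; apply/val_inj.
by rewrite /= val_iter addnA subnKC ?(ltnW (ltn_ord i)) // modnDl modn_small.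
Qed.

Lemma vecA_independent (c : 'I_h.+1 -> L) (x : 'I_h.+1 -> 'rV[L]_m) :
    (forall i, a i != 0) ->
    ~ (exists b : L, KA q a = b ^+ (\sum_(i < m) q ^ i)%N) ->
    (exists k, c k != 0) ->
    \sum_k c k *: (vecA a h (x k) : 'rV[L]_(h.+1 * m)) = 0 ->
  exists2 e : 'I_h.+1 -> F, exists k, e k != 0
    & \sum_k e k *: (x k : resScalars 'rV[L]_m) = 0.
Proof.
move=> a_neq0 notK c_neq0 /rowP cx0.
have low i j : (j < h)%N -> \sum_k c k * frob j (x k 0 i) = 0.
  move=> lt_jh; have lt_jh1 := ltnW lt_jh : (j < h.+1)%N.
  have := cx0 (mxvec_index (Ordinal lt_jh1) i).
  rewrite summxE mxE => cx; rewrite -[RHS]cx; apply: eq_bigr => k _.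
  by rewrite mxE vecA_lowE.
pose A i := \sum_k c k * frob h (x k 0 i).
pose B i := \sum_k c k * frob h.+1 (x k 0 i).
have top i : A i = - (a (ordS i) * B (ordS i)).
  apply/eqP; rewrite -addr_eq0; apply/eqP.
  have := cx0 (mxvec_index ord_max i).
  rewrite summxE mxE => cx; rewrite -[RHS]cx mulr_sumr -big_split.
  apply: eq_bigr => k _.
  by rewrite mxE vecA_topE mulrDr (mulrCA (a _)).
have [/existsP[i0 freeX] | /existsPn dep] :=
    boolP [exists i, free [tuple x k 0 i | k < h.+1]].
  case: notK.
  have topX := orth_top_neq0 freeX c_neq0 (low i0).
  have /fin_all_exists[l xl] i : exists b, forall k, x k 0 i = b * x k 0 i0.
    exact: orth_proportional freeX (low i0) topX (low i).
  have Al i : A i = frob h (l i) * A i0.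
    by rewrite mulr_sumr; apply: eq_bigr => k _; rewrite xl frobM mulrCA.
  have Bl i : B i = frob h.+1 (l i) * B i0.
    by rewrite mulr_sumr; apply: eq_bigr => k _; rewrite xl frobM mulrCA.
  have A_eq0 i : (A i == 0) = (l i == 0).
    by rewrite Al mulf_eq0 (negPf topX) orbF frob_eq0.
  (* Nonvanishing spreads along the cycle from [i0]: [A i != 0] forces [B (ordS i) != 0] by [top],
     hence [l (ordS i) != 0]. *)
  have l_neq0 i : l i != 0.
    have [t <-] := iter_ordS_onto i0 i; elim: t => [|t]; rewrite -A_eq0 //=.
    rewrite top oppr_eq0 mulf_eq0 (negPf (a_neq0 _)) Bl mulf_eq0 frob_eq0.
    by move=> /=; case/norP.
  have B_neq0 : B i0 != 0.
    move: topX; rewrite -/(A i0) top oppr_eq0 mulf_eq0 (negPf (a_neq0 _)) /= Bl.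
    by rewrite mulf_eq0; case/norP.
  apply: (KA_is_power (l := fun i => frob h (l i)) (u := - A i0 / B i0)).
  - exact: ltnW (finNzRing_gt1 F).
  - exact: leq_ltn_trans (ltn_ord i0).
  - by move=> i; rewrite frob_eq0.
  move=> i; apply: (mulIf B_neq0); rewrite -exprM -expnSr -mulrA -Bl.
  by rewrite mulrAC divfK // mulNr [A i0 * _]mulrC -Al top opprK.
have [k0 ck0] := c_neq0.
have [s gs] : exists s, coord (vbasis {:L}) s (c k0) != 0.
  apply/existsP; apply: contraNT ck0 => /existsPn g0.
  rewrite (coord_vbasis (memvf (c k0))) big1 // => s _.
  by rewrite (eqP (negPn (g0 s))) scale0r.
exists (fun k => coord (vbasis {:L}) s (c k)); first by exists k0.
apply/rowP => i; rewrite [RHS]mxE.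
transitivity (\sum_k coord (vbasis {:L}) s (c k) *: x k 0 i).
  by rewrite summxE; apply: eq_bigr => k _; rewrite mxE mulr_algl.
apply: (@orth_descent F L _ c _ (coord (vbasis {:L}) s)) => f.
apply: (@orth_linear F L _ h c (fun k => x k 0 i) f _ (low i)).
(* Dependence bounds the span of the [h+1] entries by dimension [h], so the [h] relations in [low]
   suffice. *)
rewrite -ltnS ltn_neqAle; have := dep i; rewrite /free size_tuple => -> /=.
by rewrite -[X in (_ <= X)%N](size_tuple [tuple x k 0 i | k < h.+1]) dim_span.
Qed.

Lemma vecA_inj : (0 < h)%N -> injective (vecA a h).
Proof.
move=> h_gt0 x y xy; apply/rowP => i.
have := congr1 (fun v : 'rV[L]_(h.+1 * m) => v 0 (mxvec_index ord0 i)) xy.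
by rewrite /= !vecA_lowE // /frob expn0 !expr1.
Qed.

Lemma dim_VA : (0 < h)%N -> \dim (VA a h) = (m * \dim {:L})%N.
Proof.
move=> h_gt0; rewrite /VA limg_dim_eq; last first.
  apply/eqP; rewrite -subv0; apply/subvP => x /memv_capP[_].
  rewrite memv_ker lfunE memv0 /= -(linear0 (vecA a h)) inj_eq //.
  exact: vecA_inj.
exact: dim_resScalars_row.
Qed.

(** With [h+2] independent scalars, [L]-combinations separate the exponents [0, ..., h+1], and so
    reach every unit vector. *)
Lemma extSpan_VA : (h.+2 <= \dim {:L})%N -> extSpan (VA a h) = fullv.
Proof.
move=> h_lt; apply/eqP; rewrite eqEsubv subvf /=.
pose y (k : 'I_h.+2) := (vbasis {:L})`_k.
have freey : free [tuple y k | k < h.+2] := free_vbasis_take h_lt.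
have Munit := moore_unit freey; set M := \matrix_(j, k) _ in Munit.
(* Column [j] of the inverse Moore matrix combines the [y k ^ (q ^ s)] to     *)
(* [(s == j)%:R]; since [j <= h] the exponent [h.+1] contributes nothing.     *)
have MV (s : 'I_h.+2) j :
    \sum_k invmx M k j * frob s (y k) = (s == j)%:R.
  have /matrixP/(_ s j) := mulmxV Munit; rewrite !mxE => <-.
  by apply: eq_bigr => k _; rewrite [M _ _]mxE mulrC.
have sel (s : 'I_h.+2) j (i i' : 'I_m) :
    \sum_k invmx M k j * frob s ((y k *: delta_mx 0 i : 'rV[L]_m) 0 i')
     = ((i' == i) && (s == j))%:R.
  rewrite -mulnb natrM -MV mulr_sumr; apply: eq_bigr => k _.
  rewrite !mxE eqxx /=; case: (i' == i).
    by rewrite mulr1 mul1r.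
  by rewrite mulr0 linear0 mulr0 mul0r.
apply/subvP => v _; rewrite (row_sum_delta v); apply: memv_suml => ji _.
apply: memvZ; case/mxvec_indexP: ji => j i.
have -> : delta_mx 0 (mxvec_index j i) =
    \sum_(k < h.+2) invmx M k (widen_ord (leqnSn _) j) *:
       (vecA a h (y k *: delta_mx 0 i) : 'rV[L]_(h.+1 * m)).
  apply/rowP => ji; case/mxvec_indexP: ji => j' i'.
  rewrite -mxvec_delta mxvecE mxE summxE.
  have [lt_jh | ] := ltnP j' h.
    under eq_bigr => k _ do rewrite mxE vecA_lowE //.
    by rewrite (sel (widen_ord (leqnSn _) j')) -!val_eqE /= andbC.
  rewrite leq_eqVlt (ltnNge h) -ltnS ltn_ord orbF eq_sym => /eqP j'h.
  have -> : j' = ord_max by apply/val_inj.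
  under eq_bigr => k _ do rewrite mxE vecA_topE mulrDr (mulrCA _ (a _)).
  rewrite big_split /= -mulr_sumr (sel (widen_ord (leqnSn _) ord_max)).
  rewrite (sel ord_max).
  rewrite -!val_eqE /= andbC [h.+1 == _]gtn_eqF ?ltn_ord // andbF.
  by rewrite mulr0 addr0.
apply: memv_suml => k _; apply: memvZ.
apply: (elimT (extSpan_subvP _ _) (subvv _)); apply/mem_VA.
by exists (y k *: delta_mx 0 i).
Qed.

Lemma VA_meet (W : {vspace 'rV[L]_(h.+1 * m)}) :
    (forall i, a i != 0) ->
    ~ (exists b : L, KA q a = b ^+ (\sum_(i < m) q ^ i)%N) ->
  (0 < h)%N -> \dim W = h -> (\dim (VA a h :&: resSpace W) <= h)%N.
Proof.
move=> a_neq0 notK h_gt0 dimW; rewrite leqNgt; apply/negP => lt_h.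
set U := (_ :&: _)%VS in lt_h.
pose u (k : 'I_h.+1) : resScalars 'rV[L]_(h.+1 * m) := (vbasis U)`_k.
have Uu k : u k \in U.
  by apply/vbasis_mem/mem_nth; rewrite size_tuple (leq_trans (ltn_ord k)).
have /fin_all_exists[x xu] k : exists x, u k = vecA a h x.
  by apply/mem_VA; have [] := memv_capP (Uu k).
have freeL : free [tuple (u k : 'rV[L]_(h.+1 * m)) | k < h.+1].
  apply/freeP => c c0 i; apply/eqP/negPn/negP => ci.
  have [|e [k]] := vecA_independent (x := x) a_neq0 notK (ex_intro _ i ci).
    rewrite -[RHS]c0; apply: eq_bigr => j _.
    by rewrite -xu -tnth_nth tnth_mktuple.
  (* By linearity of [vecA], the [F]-relation among the preimages carries over to the
     [F]-independent [u k]. *)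
  move=> /eqP ek0 ex0; apply: ek0; move/freeP: (free_vbasis_take lt_h); apply.
  rewrite -[RHS](linear0 (vecA a h)) -[in RHS]ex0 linear_sum.
  apply: eq_bigr => j _.
  by rewrite -tnth_nth tnth_mktuple linearZ /= -xu.
have := freeL; rewrite /free size_tuple => /eqP dim_u.
suff /dimvS : (<<[tuple (u k : 'rV[L]_(h.+1 * m)) | k < h.+1]>> <= W)%VS.
  by rewrite dim_u dimW ltnn.
apply/span_subvP => _ /tnthP[k ->].
by rewrite tnth_mktuple -mem_resSpace; have [] := memv_capP (Uu k).
Qed.

End Scattered.

Theorem theorem2p1 (F : finFieldType) (L : fieldExtType F) (q n m h : nat)
    (hq : #|F| = q) (hn : \dim {:L} = n)
    (hm : (3 <= m)%N) (hh : (2 <= h)%N) (hhn : (h <= n - 2)%N)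
    (alpha : 'I_m -> L) (alpha_neq0 : forall i, alpha i != 0)
    (hK : ~ exists b : L, KA q alpha = b ^+ (\sum_(i < m) q ^ i)%N) :
  maximum_hscattered h (VA alpha h).
Proof.
subst q n; have h_gt0 : (0 < h)%N := ltnW hh.
have h_lt : (h.+2 <= \dim {:L})%N.
  by rewrite -add2n -leq_psubRL.
have dimV : \dim {:'rV[L]_(h.+1 * m)} = (h.+1 * m)%N.
  by rewrite dimvf /dim /= mul1n.
have spanV := extSpan_VA alpha h_lt.
split; first split => //.
- by rewrite h_gt0 dimV -ltnS prednK ?leq_pmulr ?muln_gt0 /= ?(leq_trans _ hm).
- by move=> W; apply: VA_meet.
(* A subgeometry would give [mn = m(h+1)], so [n = h+1], against [h+2 <= n]. *)
- rewrite /defines_subgeometry dim_VA // dimV mulnC => -[/eqP].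
  rewrite eqn_pmul2r ?(leq_trans _ hm) // => /eqP hL _.
  by rewrite hL ltnn in h_lt.
rewrite dim_VA // dimV -mulnA (natrM _ h.+1) [RHS]mulrC mulKf //.
by rewrite Num.Theory.pnatr_eq0.
Qed.
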